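(* Let $(X,d)$ be a compact metric space and let $f_{1,\infty}=\{f_n:X\to X\}_{n=1}^{\infty}$ be a nonautonomous discrete dynamical system on $X$, i.e. a sequence of continuous self-maps of $X$, with $h_{\mathrm{Mis}}(f_{1,\infty})<+\infty$. Then there exists an upper semi-continuous function $\mathfrak{h}^{\mathrm{Mis}}_{f_{1,\infty}}:\mathcal{P}(X)\to\mathbb{R}$ such that $$P_{\mathrm{Mis}}(f_{1,\infty},\varphi)=\max_{\mu\in\mathcal{P}(X)}\left\{\mathfrak{h}^{\mathrm{Mis}}_{f_{1,\infty}}(\mu)+\int_X\varphi\,d\mu\right\}\qquad\forall\,\varphi\in C(X)$$ and $$\mathfrak{h}^{\mathrm{Mis}}_{f_{1,\infty}}(\mu)=\inf_{\varphi\in C(X)}\left\{P_{\mathrm{Mis}}(f_{1,\infty},\varphi)-\int\varphi\,d\mu\right\}\qquad\forall\,\mu\in\mathcal{P}(X).$$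
   Context: $\mathcal{P}(X)$ is the space of Borel probability measures on $X$ with the weak$^*$ topology; $C(X)$ is the space of continuous functions $\varphi:X\to\mathbb{R}$ (potentials) with the supremum norm. Let $\mathcal{W}$ be the set of all neighborhoods of the diagonal $\{(x,x):x\in X\}$ in $X\times X$. For $n\in\mathbb{N}$ and $\delta\in\mathcal{W}$ let $$\delta_n=\bigcap_{i=1}^n\big(f_i\circ\cdots\circ f_1\times f_i\circ\cdots\circ f_1\big)^{-1}\delta .$$ A finite set $E\subset X$ is $(n,\delta)_M$-separated if $(x,y)\notin\delta_n$ for any distinct points $x,y\in E$. For $\varphi\in C(X)$ put $$P_{n,\delta}(f_{1,\infty},\varphi)=\sup_E\Big\{\log\sum_{x\in E}\exp\Big[\sum_{i=1}^n\varphi(f_i\circ\cdots\circ f_1(x))\Big]:E\subset X\text{ is }(n,\delta)_M\text{-separated}\Big\},$$ $$P_\delta(f_{1,\infty},\varphi)=\limsup_{n\to\infty}\frac1nP_{n,\delta}(f_{1,\infty},\varphi).$$ The Misiurewicz pressure is $P_{\mathrm{Mis}}(f_{1,\infty},\varphi)=\sup_{\delta\in\mathcal{W}}P_\delta(f_{1,\infty},\varphi)$, and the Misiurewicz entropy is $h_{\mathrm{Mis}}(f_{1,\infty})=P_{\mathrm{Mis}}(f_{1,\infty},0)$.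
   Formalization: The function h takes values in R ∪ {−∞} (h < +∞) instead of R: for X = {p,q} and all f_n constantly p, the second formula gives h(δ_q) = inf(φ(p) − φ(q)) = −∞; X is taken nonempty. *)

(* Defs.v *)
(* MathComp-Analysis; potentials, pressures and measures are over an abstract
   R : realType. *)
From HB Require Import structures.
From mathcomp Require Import all_boot all_order all_algebra finmap.
From mathcomp Require Import all_classical all_reals all_analysis.

Set Implicit Arguments.
Unset Strict Implicit.
Unset Printing Implicit Defensive.

Import Order.TTheory GRing.Theory Num.Theory.
Import numFieldNormedType.Exports.

Local Open Scope classical_set_scope.
Local Open Scope ring_scope.

(* Nonempty metric spaces. The distinguished point is required by the library
   to form sigma-algebras; none of the definitions below depends on it. *)
#[short(type="pmetricType")]
HB.structure Definition PMetric (K : numDomainType) :=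
  { M of Metric K M & isPointed M }.

(* The library only has the lower version, with the same phrasing. *)
Definition upper_semicontinuous {T : topologicalType} {R : numFieldType}
    (h : T -> \bar R) :=
  forall x a, (h x < a%:E)%E ->
    exists2 V, nbhs x V & forall y, V y -> (h y < a%:E)%E.

Definition is_maximum {R : numDomainType} (A : set (\bar R)) (m : \bar R) :=
  A m /\ ubound A m.

Section borel_probability.
Context {R : realType} (X : pmetricType R).

Definition borelType := g_sigma_algebraType (@open X).

Definition borel_probability := probability borelType R.

Definition weakstar_pairing (mu : borel_probability) :
    {ptws continuousType X R -> R} :=
  fun phi => \int[mu]_x phi x.

(* The coarsest topology making mu |-> \int phi dmu continuous for every
   continuous phi. *)
Definition weakstar_probability := initial_topology weakstar_pairing.

HB.instance Definition _ :=
  Topological.copy weakstar_probability (initial_topology weakstar_pairing).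

End borel_probability.

Section misiurewicz_pressure.
Context {R : realType} {X : topologicalType}.
(* The sequence is indexed from 0: f i is the map usually written f_(i+1). *)
Variable f : nat -> X -> X.

(* f_n \o ... \o f_1 *)
Fixpoint nads_iter (n : nat) : X -> X :=
  if n is m.+1 then f m \o nads_iter m else id.

Definition dyn_nbhd (n : nat) (delta : set (X * X)) : set (X * X) :=
  \bigcap_(i in [set i | (1 <= i <= n)%N])
    (fun z => (nads_iter i z.1, nads_iter i z.2)) @^-1` delta.

Definition separated_M (n : nat) (delta : set (X * X)) (E : {fset X}) :=
  forall x y, x \in E -> y \in E -> x != y -> ~ dyn_nbhd n delta (x, y).

(* lne is the extended logarithm: lne 0 = -oo, which is the contribution of the
   empty separated set (ln 0 = 0 would be wrong here). *)
Definition pressure_n (n : nat) (delta : set (X * X)) (phi : X -> R) : \bar R :=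
  ereal_sup
    [set lne (\sum_(x <- E)
                expR (\sum_(1 <= i < n.+1) phi (nads_iter i x)))%:E
    | E in separated_M n delta].

Definition pressure_delta (delta : set (X * X)) (phi : X -> R) : \bar R :=
  limn_esup (fun n => (n%:R^-1)%:E * pressure_n n delta phi)%E.

Definition pressure_Mis (phi : X -> R) : \bar R :=
  ereal_sup
    [set pressure_delta delta phi
    | delta in set_nbhs (@diagonal X)].

End misiurewicz_pressure.

Definition entropy_Mis (R : realType) (X : topologicalType)
    (f : nat -> X -> X) : \bar R :=
  pressure_Mis f (fun _ => 0 : R).

(* Main.v *)
(* The equilibrium measure at phi0 is obtained without convex separation: the
   Gibbs weights exp(S_n phi0) / Z on a nearly optimal (n, delta)-separated set
   give a positive normalised functional which, by Jensen's inequality, is a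
   subgradient of log-sum-exp at phi0. Ultrafilter limits, first in n and then
   along a -> P(phi0), turn these into a state L on C(X) with
   P(phi0) + L psi <= P(phi0 + psi) for every psi. The Riesz measure mu of L
   then attains the infimum defining h(mu) at phi0, so h(mu) + int phi0 dmu
   equals P(phi0). *)
From HB Require Import structures.
Require Import Defs.
From mathcomp Require Import all_boot all_order all_algebra finmap.
From mathcomp Require Import all_classical all_reals all_analysis.
From mathcomp Require Import measurable_realfun ring lra.
Import Order.TTheory GRing.Theory Num.Theory.
Import numFieldNormedType.Exports.

Local Open Scope classical_set_scope.
Local Open Scope ring_scope.

Set Implicit Arguments.
Unset Strict Implicit.
Unset Printing Implicit Defensive.

(** * States on C(X) *)

Section continuity.
Context {R : realType} {X : topologicalType}.
Implicit Types f g : X -> R.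

Lemma continuous_scale a f : continuous f -> continuous (fun x => a * f x).
Proof. by move=> cf x; apply: cvgM; [exact: cvg_cst|exact: cf]. Qed.

Lemma continuous_add f g : continuous f -> continuous g ->
  continuous (fun x => f x + g x).
Proof. by move=> cf cg x; apply: cvgD; [exact: cf|exact: cg]. Qed.

Lemma continuous_sub f g : continuous f -> continuous g ->
  continuous (fun x => f x - g x).
Proof. by move=> cf cg x; apply: cvgB; [exact: cf|exact: cg]. Qed.

Lemma continuous_sum (F : nat -> X -> R) n : (forall i, continuous (F i)) ->
  continuous (fun x => \sum_(i < n) F i x).
Proof.
move=> cF; elim: n => [|n IH].
  by under eq_fun do rewrite big_ord0; move=> x; exact: cvg_cst.
by under eq_fun do rewrite big_ord_recr/=; exact: continuous_add.
Qed.

Lemma continuous_minr f g : continuous f -> continuous g ->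
  continuous (fun x => Num.min (f x) (g x)).
Proof. by move=> cf cg x; apply: continuous_min; [exact: cf|exact: cg]. Qed.

Lemma continuous_maxr f g : continuous f -> continuous g ->
  continuous (fun x => Num.max (f x) (g x)).
Proof. by move=> cf cg x; apply: continuous_max; [exact: cf|exact: cg]. Qed.

Lemma continuous_cst (c : R) : continuous (fun _ : X => c).
Proof. by move=> x; exact: cvg_cst. Qed.

Lemma bounded_continuous f : compact [set: X] -> continuous f ->
  exists M, forall x, `|f x| <= M.
Proof.
move=> cX cf.
have : compact (f @` [set: X]).
  by apply: continuous_compact => //; exact: continuous_subspaceT.
move=> /compact_bounded[M [_ hM]]; exists (M + 1) => x.
by apply: (hM _ _ (f x)); [rewrite ltrDl | exists x].
Qed.

End continuity.

(* A positive normalised linear functional on C(X); its values on discontinuous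
   functions are junk. *)
Definition state {R : realType} {X : topologicalType} (L : (X -> R) -> R) :=
  [/\ forall (a : R) (f g : X -> R), continuous f -> continuous g ->
        L (fun x => a * f x + g x) = a * L f + L g,
      forall f : X -> R, continuous f -> (forall x, 0 <= f x) -> 0 <= L f
    & L (fun=> 1) = 1].

Section state_theory.
Context {R : realType} {X : topologicalType} (L : (X -> R) -> R).
Hypothesis sL : state L.
Implicit Types f g : X -> R.

Let linL (a : R) (f g : X -> R) : continuous f -> continuous g ->
  L (fun x => a * f x + g x) = a * L f + L g.
Proof. by case: sL => + _ _; exact. Qed.

Lemma state_add f g : continuous f -> continuous g ->
  L (fun x => f x + g x) = L f + L g.
Proof.
move=> cf cg; rewrite -[L f]mul1r -linL//; congr L.
by apply/funext => x; rewrite mul1r.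
Qed.

Lemma state0 : L (fun=> 0) = 0.
Proof.
have := state_add (@continuous_cst R X 0) (@continuous_cst R X 0).
by under eq_fun do rewrite addr0; lra.
Qed.

Lemma state_scale a f : continuous f -> L (fun x => a * f x) = a * L f.
Proof.
move=> cf; rewrite -[RHS]addr0 -state0 -linL//; last exact: continuous_cst.
by under [in RHS]eq_fun do rewrite addr0.
Qed.

Lemma state_sub f g : continuous f -> continuous g ->
  L (fun x => f x - g x) = L f - L g.
Proof.
move=> cf cg; rewrite -[- L g]mulN1r -state_scale// -state_add//.
  by congr L; apply/funext => x; rewrite mulN1r.
exact: continuous_scale.
Qed.

Lemma state_cst c : L (fun=> c) = c.
Proof.
have [_ _ L1] := sL; rewrite -[RHS]mulr1 -[X in _ = c * X]L1 -state_scale.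
  by under [in RHS]eq_fun do rewrite mulr1.
exact: continuous_cst.
Qed.

Lemma le_state f g : continuous f -> continuous g ->
  (forall x, f x <= g x) -> L f <= L g.
Proof.
move=> cf cg fg; rewrite -subr_ge0 -state_sub//.
case: sL => _ + _; apply; first exact: continuous_sub.
by move=> x; rewrite subr_ge0.
Qed.

Lemma state_sum (F : nat -> X -> R) n : (forall i, continuous (F i)) ->
  L (fun x => \sum_(i < n) F i x) = \sum_(i < n) L (F i).
Proof.
move=> cF; elim: n => [|n IH].
  by rewrite big_ord0 -[RHS]state0; under eq_fun do rewrite big_ord0.
under eq_fun do rewrite big_ord_recr/=.
by rewrite state_add ?IH ?big_ord_recr//; exact: continuous_sum.
Qed.

Lemma state_norm_le f M : continuous f -> (forall x, `|f x| <= M) ->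
  `|L f| <= M.
Proof.
move=> cf fM; rewrite ler_norml; apply/andP; split.
  rewrite -[- M]state_cst; apply: le_state => //; first exact: continuous_cst.
  by move=> x; have := fM x; rewrite ler_norml => /andP[].
rewrite -[leRHS]state_cst; apply: le_state => //; first exact: continuous_cst.
by move=> x; have := fM x; rewrite ler_norml => /andP[].
Qed.

End state_theory.

Lemma ultrafilter_fmap T U (f : T -> U) (F : set_system T) :
  UltraFilter F -> UltraFilter (f @ F).
Proof.
move=> UF; split=> [|G PG FG]; first exact: fmap_proper_filter.
apply/seteqP; split=> // A GA.
have [//|FnA] := in_ultra_setVsetC (f @^-1` A) UF.
have : G (A `&` ~` A) by apply: filterI => //; exact: FG.
by rewrite setICr => /filter_not_empty.
Qed.

(** For continuous [f] the values [Ls t f] stay in a compact interval [[-M, M]], so they converge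
    along one ultrafilter refining [F], the same for all [f]. This is weak-star compactness of the
    set of states, in a form that keeps every upper bound holding eventually along [F]. *)
Lemma state_limit {R : realType} {X : topologicalType} (T : Type)
    (F : set_system T) (FF : ProperFilter F) (Ls : T -> (X -> R) -> R) :
  compact [set: X] -> (forall t, state (Ls t)) ->
  exists2 L, state L & forall f c, continuous f ->
    (\forall t \near F, Ls t f <= c) -> L f <= c.
Proof.
move=> cX sLs; have [G [UG FG]] := ultraFilterLemma FF.
have GG : ProperFilter G by exact: ultra_proper.
pose L f := lim ((Ls ^~ f) @ G).
have cvL f : continuous f -> (Ls ^~ f) @ G --> L f.
  move=> cf; have [M fM] := bounded_continuous cX cf.
  have : compact `[- M, M]%classic by exact: segment_compact.
  rewrite compact_ultra => /(_ ((Ls ^~ f) @ G)).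
  have UfG : UltraFilter ((Ls ^~ f) @ G) by exact: ultrafilter_fmap.
  case/(_ UfG).
    apply: nearW => t /=; rewrite in_itv/= -ler_norml.
    exact: (state_norm_le (sLs t) cf fM).
  by move=> p [_ /= cvp]; apply/cvg_ex; exists p.
exists L; last first.
  move=> f c cf Lc; apply: limr_le; first exact: cvL.
  exact: FG.
split.
- move=> a f g cf cg; apply: cvg_lim; first exact: Rhausdorff.
  have -> : (fun t => Ls t (fun x => a * f x + g x)) =
            (fun t => a * Ls t f + Ls t g).
    by apply/funext => t; have [-> ] := sLs t.
  by apply: cvgD; [apply: cvgM; [exact: cvg_cst|exact: cvL]|exact: cvL].
- move=> f cf f0; apply: limr_ge; first exact: cvL.
  by apply: nearW => t; have [_ + _] := sLs t; exact.
- apply: cvg_lim; first exact: Rhausdorff.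
  have -> : (fun t => Ls t (fun=> 1)) = (fun=> 1).
    by apply/funext => t; have [_ _ ->] := sLs t.
  exact: cvg_cst.
Qed.

(** * Subgradients of the pressure *)

(** Jensen's inequality for the Gibbs weights [expR (a x) / Z], with [m] the Gibbs mean of [b]. It
    follows from the tangent-line bound [1 + t <= expR t] at [t = b x - m], because the factors
    [1 + (b x - m)] average to 1. *)
Lemma log_sum_exp_subgradient (R : realType) (T : Type) (s : seq T)
    (a b : T -> R) (Z := \sum_(x <- s) expR (a x)) : 0 < Z ->
  ln Z + (\sum_(x <- s) expR (a x) * b x) / Z <=
  ln (\sum_(x <- s) expR (a x + b x)).
Proof.
move=> Z0; set m := _ / Z.
have mZ : m * Z = \sum_(x <- s) expR (a x) * b x by rewrite divfK ?gt_eqF.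
rewrite -[m]expRK -lnM ?posrE ?expR_gt0//.
have Zm : Z * expR m <= \sum_(x <- s) expR (a x + b x).
  have -> : Z * expR m = \sum_(x <- s) expR m * (expR (a x) * (1 + (b x - m))).
    rewrite -big_distrr/= mulrC; congr (_ * _).
    transitivity ((1 - m) * Z + m * Z); first by ring.
    rewrite mZ /Z big_distrr -big_split/=; apply: eq_bigr => x _; ring.
  apply: ler_sum => x _.
  have -> : expR (a x + b x) = expR m * (expR (a x) * expR (b x - m)).
    by rewrite -!expRD; congr expR; ring.
  by rewrite !ler_pM2l ?expR_gt0// expR_ge1Dx.
rewrite ler_ln ?posrE ?mulr_gt0 ?expR_gt0//.
by apply: lt_le_trans Zm; rewrite mulr_gt0 ?expR_gt0.
Qed.

(** Either positivity says only that [s] is nonempty. *)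
Lemma sum_expR_gt0 (R : realType) (T : Type) (s : seq T) (a b : T -> R) :
  0 < \sum_(x <- s) expR (a x) -> 0 < \sum_(x <- s) expR (b x).
Proof.
case: s => [|x s]; first by rewrite !big_nil.
by move=> _; rewrite big_cons ltr_pwDl ?expR_gt0// sumr_ge0.
Qed.

Section pressure.
Context {R : realType} {X : topologicalType} (f : nat -> X -> X).
Hypothesis cX : compact [set: X].
Implicit Types phi psi : X -> R.

Let birkhoff n phi x := \sum_(1 <= i < n.+1) phi (nads_iter f i x).
Let Z n phi (s : seq X) := \sum_(x <- s) expR (birkhoff n phi x).

Let birkhoff_linear n a phi psi x :
  birkhoff n (fun x => a * phi x + psi x) x =
  a * birkhoff n phi x + birkhoff n psi x.
Proof. by rewrite /birkhoff big_split/= big_distrr. Qed.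

(** [L psi] is the Gibbs mean of the Birkhoff average of [psi]; the factor [n%:R^-1] turns Birkhoff
    sums into averages and so gives [L 1 = 1]. *)
Lemma gibbs_state n phi (s : seq X) : (0 < n)%N -> 0 < Z n phi s ->
  exists2 L, state L & forall psi,
    ln (Z n phi s) + n%:R * L psi <= ln (Z n (fun x => phi x + psi x) s).
Proof.
move=> n0 Z0; have n0R : (n%:R : R) != 0 by rewrite pnatr_eq0 -lt0n.
exists (fun psi => n%:R^-1 * ((\sum_(x <- s)
    expR (birkhoff n phi x) * birkhoff n psi x) / Z n phi s)).
  split.
  - move=> a g h _ _.
    under eq_bigr do rewrite birkhoff_linear mulrDr mulrCA.
    by rewrite big_split/= -big_distrr/=; ring.
  - move=> g _ g0; rewrite mulr_ge0 ?invr_ge0// divr_ge0 ?(ltW Z0)//.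
    by apply: sumr_ge0 => x _; rewrite mulr_ge0 ?expR_ge0// sumr_ge0.
  - under eq_bigr do rewrite /birkhoff (_ : \sum_(1 <= i < n.+1) 1 = n%:R)
      ?big_const_nat ?subn1 ?iter_addr_0//.
    rewrite -big_distrl/= -/(Z n phi s) mulrAC divff ?gt_eqF// mul1r.
    by rewrite mulVf.
move=> psi; rewrite mulVKf//.
apply: le_trans (log_sum_exp_subgradient _ Z0) _.
rewrite le_eqVlt; apply/orP; left; apply/eqP; congr ln.
by apply: eq_bigr => x _; rewrite /birkhoff -big_split.
Qed.

Lemma pressure_n_subgradient n delta phi (a : R) : (0 < n)%N ->
  (a%:E < n%:R^-1%:E * pressure_n f n delta phi)%E ->
  exists2 L, state L & forall psi,
    ((a + L psi)%:E <=
      n%:R^-1%:E * pressure_n f n delta (fun x => phi x + psi x)%R)%E.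
Proof.
move=> n0; have n0R : 0 < (n%:R : R) by rewrite ltr0n.
rewrite lte_pdivlMl// -EFinM => /ereal_sup_gt[_ [E sepE <-]].
rewrite -/(Z n phi E).
(* An empty separated set has [Z = 0] and contributes [-oo], which exceeds no real number. *)
have [Z0|Z0] := ltP 0 (Z n phi E); last by rewrite le0_lneNy.
rewrite lne_EFin// lte_fin => naZ.
have [L sL hL] := gibbs_state n0 Z0; exists L; first exact: sL.
move=> psi.
rewrite lee_pdivlMl// -EFinM mulrDr.
apply: le_trans (ereal_sup_ubound _); last by exists E => //.
rewrite -/(Z n (fun x => phi x + psi x) E).
have Z'0 : 0 < Z n (fun x => phi x + psi x) E by exact: sum_expR_gt0 Z0.
rewrite lne_EFin// lee_fin; apply: le_trans (hL psi).
by rewrite lerD2r ltW.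
Qed.

(** Since the limsup exceeds [a], infinitely many [n] lie in [S]. A limit of their states along [S]
    serves all [psi] at once, because the limsup over all [n] dominates any lower bound that
    persists along [S]. *)
Lemma pressure_delta_subgradient delta phi (a : R) :
  (a%:E < pressure_delta f delta phi)%E ->
  exists2 L, state L & forall psi, continuous psi ->
    ((a + L psi)%:E <= pressure_delta f delta (fun x => phi x + psi x)%R)%E.
Proof.
pose u phi n := (n%:R^-1%:E * pressure_n f n delta phi)%E.
pose S := [set n | (0 < n)%N /\ (a%:E < u phi n)%E].
move=> aP.
(* If [S] were eventually avoided, a tail supremum of [u phi] would be at most [a], and so would the
   limsup. *)
have FS : ProperFilter (within S \oo).
  apply: Build_ProperFilter => nS; move: aP; apply/negP; rewrite -leNgt.
  apply: (@le_trans _ _ (ereal_sup (u phi @` (~` S `&` [set n | (0 < n)%N])))).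
    apply: ereal_inf_lbound; exists (~` S `&` [set n | (0 < n)%N]) => //.
    by apply: filterI => //; exists 1%N.
  apply: ge_ereal_sup => _ [n [nSn n0] <-]; rewrite leNgt; apply/negP => an.
  exact: nSn.
(* [state_limit] asks for a state at every index. Off [S] any state will do, and one is borrowed
   from some member of [S]. *)
have Ls n : exists L, state L /\ (S n -> forall psi,
    ((a + L psi)%:E <= u (fun x => phi x + psi x)%R n)%E).
  have [Sn|nSn] := pselect (S n).
    by have [L sL hL] := pressure_n_subgradient Sn.1 Sn.2; exists L.
  have [m [m0 am]] := filter_ex (withinT S _ : within S \oo S).
  by have [L sL _] := pressure_n_subgradient m0 am; exists L.
have [L_ hL] := choice Ls.
have [L sL LP] := state_limit FS cX (fun n => (hL n).1).
exists L; first exact: sL.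
move=> psi cpsi.
rewrite /pressure_delta /limn_esup.
rewrite limf_esupE.
apply: le_ereal_inf_tmp => _ [V Voo <-].
have VS : \forall n \near within S \oo,
    ((a + L_ n psi)%:E <= ereal_sup (u (fun x => phi x + psi x)%R @` V))%E.
  apply: filterS Voo => n Vn Sn.
  apply: le_trans ((hL n).2 Sn psi) _.
  by apply: ereal_sup_ubound; exists n.
(* For a real supremum [r] the bound reads [L_ n psi <= r - a], which passes to [L]. The value [-oo]
   is impossible because the filter is proper. *)
case: (ereal_sup _) VS => [r| |] VS; last by case: (filter_ex VS).
  rewrite lee_fin addrC -lerBrDr; apply: LP => //.
  by apply: filterS VS => n; rewrite lee_fin addrC -lerBrDr.
by rewrite leey.
Qed.

Lemma pressure_Mis_subgradient_approx phi (a : R) :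
  (a%:E < pressure_Mis f phi)%E ->
  exists2 L, state L & forall psi, continuous psi ->
    ((a + L psi)%:E <= pressure_Mis f (fun x => phi x + psi x)%R)%E.
Proof.
move=> /ereal_sup_gt[_ [delta Wdelta <-]] /pressure_delta_subgradient[L sL hL].
exists L; first exact: sL.
move=> psi cpsi; apply: le_trans (hL psi cpsi) _.
by apply: ereal_sup_ubound; exists delta.
Qed.

(** A one-point set is separated for every neighbourhood, and its sum is [expR 0 = 1]. *)
Lemma entropy_Mis_ge0 (x0 : X) : (0 <= entropy_Mis R f)%E.
Proof.
apply: le_trans (ereal_sup_ubound _); last by exists setT => //; exact: filterT.
rewrite /pressure_delta /limn_esup; apply: limf_esup_ge0.
  exact: filter_not_empty.
move=> n; rewrite mule_ge0//; apply: le_trans (ereal_sup_ubound _); last first.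
  exists [fset x0]%fset => //.
  by move=> x y /[!inE] /eqP-> /eqP->; rewrite eqxx.
by rewrite lne_ge0 big_seq_fset1 big1// expR0.
Qed.

Hypothesis finite_entropy : (entropy_Mis R f < +oo)%E.

(** Both bounds come from approximate subgradients. One at the potential 0 with level -1, tested on
    [phi], excludes [-oo]. If the pressure were [+oo], one at [phi] with level entropy + [M] + 1,
    tested on [- phi], would push the entropy above itself, since [L (- phi) >= - M]. *)
Lemma pressure_Mis_fin_num (x0 : X) phi : continuous phi ->
  pressure_Mis f phi \is a fin_num.
Proof.
move=> cphi; rewrite fin_numE; apply/andP; split.
  have : ((-1)%:E < entropy_Mis R f)%E.
    by apply: lt_le_trans (entropy_Mis_ge0 x0); rewrite lte_fin; lra.
  move=> /pressure_Mis_subgradient_approx[L _ /(_ phi cphi)].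
  under eq_fun do rewrite add0r.
  by case: pressure_Mis.
apply/eqP => phiy.
have [M Mphi] := bounded_continuous cX cphi.
have cNphi : continuous (fun x => - phi x) by move=> x; apply: cvgN; exact: cphi.
have ent_fin : entropy_Mis R f \is a fin_num.
  by rewrite ge0_fin_numE// entropy_Mis_ge0.
have /pressure_Mis_subgradient_approx[L sL /(_ _ cNphi)] :
    ((fine (entropy_Mis R f) + M + 1)%:E < pressure_Mis f phi)%E.
  by rewrite phiy ltry.
rewrite [fun x => phi x + _](_ : _ = fun=> 0); last first.
  by apply/funext => x; rewrite subrr.
rewrite -/(entropy_Mis R f) -[leRHS]fineK// lee_fin.
have : `|L (fun x => - phi x)| <= M.
  by apply: state_norm_le => // x; rewrite normrN.
by rewrite ler_norml => /andP[]; lra.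
Qed.

Lemma pressure_Mis_subgradient (x0 : X) phi : continuous phi ->
  exists2 L, state L & forall psi, continuous psi ->
    (pressure_Mis f phi + (L psi)%:E <=
      pressure_Mis f (fun x => phi x + psi x)%R)%E.
Proof.
move=> cphi.
have Pfin psi : continuous psi -> exists p, pressure_Mis f psi = p%:E.
  move=> cpsi; exists (fine (pressure_Mis f psi)).
  by rewrite fineK//; exact: pressure_Mis_fin_num.
have [p pE] := Pfin _ cphi; rewrite pE.
have Ls n : exists L, state L /\ forall psi, continuous psi ->
    ((p - n.+1%:R^-1 + L psi)%:E <=
      pressure_Mis f (fun x => phi x + psi x)%R)%E.
  have /pressure_Mis_subgradient_approx[L sL hL] :
      ((p - n.+1%:R^-1)%:E < pressure_Mis f phi)%E.
    by rewrite pE lte_fin ltrBlDr ltrDl invr_gt0.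
  by exists L.
have [L_ hL] := choice Ls.
have [L sL LP] := state_limit (_ : ProperFilter \oo) cX (fun n => (hL n).1).
exists L; first exact: sL.
move=> psi cpsi; have [q qE] := Pfin _ (continuous_add cphi cpsi).
(* Only bounds by a fixed constant pass to [L], so the error [n.+1%:R^-1] is first absorbed into
   [e]. *)
rewrite qE lee_fin addrC -lerBrDr; apply/ler_addgt0Pr => e e0; apply: LP => //.
have : \forall n \near \oo, n.+1%:R^-1 < e.
  exact: near_infty_natSinv_lt (PosNum e0).
apply: filterS => n ne; have := (hL n).2 psi cpsi.
rewrite qE lee_fin addrAC lerBlDr addrC => PL.
by rewrite addrAC lerBrDr (le_trans PL)// lerD2l ltW.
Qed.

End pressure.

(** * The Riesz representation theorem for states *)

(** The distance to the complement of [U] works, except when [U] is the whole space, where that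
    distance is infinite and the constant 1 replaces it. *)
Lemma open_positivity_set (R : realType) (X : metricType R) (U : set X) :
  open U -> exists g : X -> R, [/\ continuous g, forall x, 0 <= g x,
    forall x, U x -> 0 < g x & forall x, ~ U x -> g x = 0].
Proof.
move=> oU; have [cU0|/set0P[a aU]] := eqVneq (~` U) set0.
  exists (fun=> 1); split=> //; first exact: continuous_cst.
  by move=> x nUx; have : (~` U) x by []; rewrite cU0.
pose d := edist_inf (~` U).
have d_fin x : d x \is a fin_num.
  rewrite ge0_fin_numE ?edist_inf_ge0//.
  apply: (@le_lt_trans _ _ (edist (x, a))).
    by apply: ereal_inf_lbound; exists a.
  rewrite -ge0_fin_numE ?edist_ge0//; apply/edist_finP.
  exists (mdist x a + 1); first by rewrite ltr_wpDl ?mdist_ge0.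
  by rewrite ballEmdist/= ltrDl.
exists (fine \o d); split.
- move=> x; apply: fine_cvg; rewrite fineK//; exact: edist_inf_continuous.
- by move=> x; rewrite fine_ge0 ?edist_inf_ge0.
- move=> x Ux; have /nbhs_ballP[e e0 xeU] := open_nbhs_nbhs (conj oU Ux).
  rewrite -lte_fin fineK//; apply: (@lt_le_trans _ _ e%:E).
    by rewrite lte_fin.
  apply: le_ereal_inf_tmp => _ [y nUy <-]; rewrite leNgt; apply/negP.
  by move=> /edist_lt_ball/xeU.
- by move=> x nUx; rewrite /= /d edist_inf0.
Qed.

(** * The outer measure of a state *)

Section riesz_outer_measure.
Context {R : realType} {X : pmetricType R} (L : (X -> R) -> R).
Hypotheses (cX : compact [set: X]) (sL : state L).
Implicit Types (U V : set X) (f g : X -> R).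

(** The usual requirement that the support of [g] lie in [U] is relaxed to vanishing off [U]. *)
Definition below_indic U g :=
  [/\ continuous g, forall x, 0 <= g x <= 1 & forall x, ~ U x -> g x = 0].

Definition inner_mass U : \bar R := ereal_sup [set (L g)%:E | g in below_indic U].

Definition riesz_outer (A : set X) : \bar R :=
  ereal_inf [set inner_mass U | U in [set U | open U /\ A `<=` U]].

Lemma below_indic0 U : below_indic U (fun=> 0).
Proof. by split=> // [|x]; [exact: continuous_cst|rewrite lexx ler01]. Qed.

Lemma inner_mass_ge0 U : (0 <= inner_mass U)%E.
Proof.
apply: ereal_sup_ubound; exists (fun=> 0); first exact: below_indic0.
by rewrite state0.
Qed.

Lemma inner_mass_le1 U : (inner_mass U <= 1)%E.
Proof.
apply: ge_ereal_sup => _ [g [cg g01 _] <-]; rewrite lee_fin.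
rewrite -[leRHS](state_cst sL); apply: le_state => //.
  exact: continuous_cst.
by move=> x; case/andP: (g01 x).
Qed.

Lemma inner_mass_fin U : inner_mass U \is a fin_num.
Proof.
by rewrite ge0_fin_numE ?inner_mass_ge0// (le_lt_trans (inner_mass_le1 _))// ltry.
Qed.

Lemma le_inner_mass U V : U `<=` V -> (inner_mass U <= inner_mass V)%E.
Proof.
move=> UV; apply: ereal_sup_le => _ [g [cg g01 g0] <-]; exists g => //.
by split=> // x nVx; apply: g0 => /UV.
Qed.

Lemma inner_massT : inner_mass setT = 1%E.
Proof.
apply/eqP; rewrite eq_le inner_mass_le1/=; apply: ereal_sup_ubound.
exists (fun=> 1); last by rewrite state_cst.
by split=> [|x|x []//]; [exact: continuous_cst|rewrite ler01 lexx].
Qed.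

Lemma inner_mass0 : inner_mass set0 = 0%E.
Proof.
apply/eqP; rewrite eq_le inner_mass_ge0 andbT.
apply: ge_ereal_sup => _ [g [_ _ g0] <-].
have -> : g = fun=> 0 by apply/funext => x; exact: g0.
by rewrite state0.
Qed.

Lemma riesz_outer_open U : open U -> riesz_outer U = inner_mass U.
Proof.
move=> oU; apply/eqP; rewrite eq_le; apply/andP; split.
  by apply: ereal_inf_lbound; exists U => //; split.
by apply: le_ereal_inf_tmp => _ [V [_ UV] <-]; exact: le_inner_mass.
Qed.

Lemma riesz_outer_ge0 A : (0 <= riesz_outer A)%E.
Proof. by apply: le_ereal_inf_tmp => _ [U _ <-]; exact: inner_mass_ge0. Qed.

Lemma le_riesz_outer A B : A `<=` B -> (riesz_outer A <= riesz_outer B)%E.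
Proof.
move=> AB; apply: ereal_inf_le_tmp => _ [U [oU BU] <-].
by exists U => //; split=> //; exact: subset_trans BU.
Qed.

Lemma riesz_outer_fin A : riesz_outer A \is a fin_num.
Proof.
rewrite ge0_fin_numE ?riesz_outer_ge0//.
apply: le_lt_trans (le_riesz_outer (@subsetT _ A)) _.
by rewrite riesz_outer_open ?inner_massT ?ltry//; exact: openT.
Qed.

Lemma inner_mass_bigcup (U : (set X)^nat) : (forall n, open (U n)) ->
  (inner_mass (\bigcup_n U n) <= \sum_(i <oo) inner_mass (U i))%E.
Proof.
move=> oU; apply: ge_ereal_sup => _ [f [cf f01 f0] <-].
have [g_ gP] := choice (fun n => open_positivity_set (oU n)).
(* For each [i] these functions increase with [n] to the indicator of [U i]. *)
pose h n i x := Num.min 1 (n%:R * g_ i x).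
have ch n i : continuous (h n i).
  apply: continuous_minr; first exact: continuous_cst.
  by apply: continuous_scale; have [] := gP i.
have h01 n i x : 0 <= h n i x <= 1.
  rewrite /h ge_min lexx/= andbT le_min ler01/= mulr_ge0//.
  by have [_ + _ _] := gP i; exact.
have hU n i : below_indic (U i) (h n i).
  split=> // x nUx; rewrite /h; have [_ _ _ ->//] := gP i.
  by rewrite mulr0; apply/min_idPr; exact: ler01.
apply/lee_addgt0Pr => e e0.
(* Dini: the partial sums of h n increase with n and eventually exceed f - e at
   each point, hence uniformly. *)
have : \forall n \near \oo, [set: X] `<=`
    (fun x => f x - e < \sum_(i < n) h n i x).
  (* Compactness in near-covering form: a rank valid near each point yields ranks valid on all of
     [X]. *)
  move/compact_near_coveringP : cX; apply => x _.
  have [N xN] : exists N, f x - e < \sum_(i < N) h N i x.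
    have [[i _ Uix]|nUx] := pselect ((\bigcup_n U n) x); last first.
      by exists 0%N; rewrite big_ord0 f0// sub0r oppr_lt0.
    have gx0 : 0 < g_ i x by have [_ _ + _] := gP i; exact.
    have [k kg] : exists k : nat, (g_ i x)^-1 < k%:R.
      exists (Num.trunc (g_ i x)^-1).+1; exact: truncnS_gt.
    (* Exceeding [i] makes the [i]-th term occur in the sum; being at least [k] makes that term
       equal to 1, which already bounds [f x]. *)
    exists (maxn k i.+1).
    have iN : (i < maxn k i.+1)%N by rewrite leq_max ltnSn orbT.
    rewrite (bigD1 (Ordinal iN))//=.
    have -> : h (maxn k i.+1) i x = 1.
      apply/min_idPl; rewrite -ler_pdivrMr// div1r.
      by rewrite (le_trans (ltW kg))// ler_nat leq_maxl.
    rewrite ltrBlDr; apply: (@le_lt_trans _ _ 1); first by case/andP: (f01 x).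
    rewrite -addrA ltrDl ltr_wpDl// sumr_ge0// => j _.
    by case/andP: (h01 (maxn k i.+1) j x).
  have : \forall y \near x, f y - e < \sum_(i < N) h N i y.
    have cs : continuous (fun y => \sum_(i < N) h N i y - (f y - e)).
      apply: continuous_sub; first exact: continuous_sum.
      by apply: continuous_sub => //; exact: continuous_cst.
    have : \forall y \near x, 0 < \sum_(i < N) h N i y - (f y - e).
      by apply: (cvgr_gt _ (cs x)); rewrite subr_gt0.
    by apply: filterS => y; rewrite subr_gt0.
  move=> xN'.
  exists ([set y | f y - e < \sum_(i < N) h N i y], [set n | (N <= n)%N]).
    by split=> //; exists N.
  move=> [y n]/= [yN Nn]; apply: lt_le_trans yN _.
  rewrite -(subnKC Nn) big_split_ord/= ler_wpDr//.
    by apply: sumr_ge0 => j _; case/andP: (h01 (N + (n - N))%N (N + j)%N y).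
  apply: ler_sum => j _; rewrite /h le_min ge_min lexx/=.
  rewrite ge_min; apply/orP; right.
  by rewrite ler_wpM2r ?ler_nat ?leq_addr//; have [_ + _ _] := gP j; exact.
move=> /filter_ex[n hn].
have Ln : L f - e <= \sum_(i < n) L (h n i).
  rewrite -state_sum// -[e in L f - e](state_cst sL) -state_sub//; last first.
    exact: continuous_cst.
  apply: le_state => //.
  - by apply: continuous_sub => //; exact: continuous_cst.
  - exact: continuous_sum.
  - by move=> x; apply: ltW; exact: hn.
apply: (@le_trans _ _ ((\sum_(i < n) inner_mass (U i)) + e%:E)%E); last first.
  rewrite leeD2r// -(big_mkord xpredT (fun i => inner_mass (U i))).
  by apply: nneseries_lim_ge => i _ _; exact: inner_mass_ge0.
apply: (@le_trans _ _ ((\sum_(i < n) L (h n i)) + e)%:E).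
  by rewrite lee_fin -lerBlDr.
rewrite EFinD leeD2r// -sumEFin; apply: lee_sum => i _.
by apply: ereal_sup_ubound; exists (h n i).
Qed.

Lemma riesz_outer_sigma_subadditive : sigma_subadditive riesz_outer.
Proof.
move=> A; apply/lee_addgt0Pr => e e0.
apply: le_trans (epsilon_trick xpredT (fun n => riesz_outer_ge0 (A n)) (ltW e0)).
have UP n : exists U, [/\ open U, A n `<=` U &
    (inner_mass U <= riesz_outer (A n) + (e / (2 ^ n.+1)%:R)%:E)%E].
  have en0 : 0 < e / (2 ^ n.+1)%:R by rewrite divr_gt0// ltr0n expn_gt0.
  have [_ [U [oU AU] <-] UA] := lb_ereal_inf_adherent en0 (riesz_outer_fin (A n)).
  by exists U; split=> //; exact: ltW.
have [U_ hU] := choice UP.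
apply: (@le_trans _ _ (inner_mass (\bigcup_n U_ n))).
  rewrite -riesz_outer_open; last by apply: bigcup_open => n _; have [] := hU n.
  apply: le_riesz_outer => x [n _ Anx]; exists n => //.
  by have [_ + _] := hU n; exact.
apply: le_trans (inner_mass_bigcup _) _ => [n|]; first by have [] := hU n.
by apply: lee_nneseries => n *; [exact: inner_mass_ge0|have [] := hU n].
Qed.

(** Take [f] nearly optimal for [V] inside [U]. The rest of [V] lies in the open set [W] where
    [f < e / 3]; take [g] nearly optimal for [W]. Then [f + g <= 1 + e / 3], so after rescaling it
    is a competitor for [V]. The three losses of [e / 3] are the two choices and the rescaling. *)
Lemma open_caratheodory U A : open U ->
  (riesz_outer (A `&` U) + riesz_outer (A `&` ~` U) <= riesz_outer A)%E.
Proof.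
move=> oU; apply: le_ereal_inf_tmp => _ [V [oV AV] <-].
have oVU : open (V `&` U) by exact: openI.
apply: (@le_trans _ _ (inner_mass (V `&` U) + riesz_outer (V `&` ~` U))%E).
  rewrite -riesz_outer_open//.
  by apply: leeD; apply: le_riesz_outer; exact: setSI.
apply/lee_addgt0Pr => e e0.
have e3 : 0 < e / 3 by rewrite divr_gt0.
have [_ [f [cf f01 f0] <-] fe] :=
  ub_ereal_sup_adherent e3 (inner_mass_fin (V `&` U)).
have oW : open (V `&` [set x | f x < e / 3]).
  by apply: openI => //; move/continuousP : cf => /(_ _ (@open_lt _ (e / 3))).
set W := V `&` _ in oW.
have [_ [g [cg g01 g0] <-] ge] := ub_ereal_sup_adherent e3 (inner_mass_fin W).
have VUW : V `&` ~` U `<=` W.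
  by move=> x [Vx nUx]; split=> //=; rewrite f0 => [|[]].
pose k x := (1 + e / 3)^-1 * (f x + g x).
have e31 : 0 < 1 + e / 3 by rewrite addr_gt0.
have cfg : continuous (fun x => f x + g x) by exact: continuous_add.
have kV : below_indic V k.
  split=> [|x|x nVx]; first exact: continuous_scale.
    have /andP[fx0 fx1] := f01 x; have /andP[gx0 gx1] := g01 x.
    rewrite /k mulr_ge0 ?addr_ge0 ?invr_ge0 ?(ltW e31)//=.
    rewrite mulrC ler_pdivrMr// mul1r.
    have [Wx|nWx] := pselect (W x).
      by rewrite addrC lerD// ltW//; case: Wx.
    by rewrite g0// addr0 (le_trans fx1)// lerDl ltW.
  by rewrite /k f0 ?g0 ?addr0 ?mulr0 => // -[].
have Lk : ((L f + L g)%:E <= inner_mass V + (e / 3)%:E)%E.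
  have -> : L f + L g = (1 + e / 3) * L k.
    by rewrite state_scale// mulrA divff ?gt_eqF// mul1r state_add.
  (* This caps the cost [(e / 3) * L k] of undoing the rescaling. *)
  have k1 : L k <= 1.
    rewrite -lee_fin; apply: le_trans (inner_mass_le1 V).
    by apply: ereal_sup_ubound; exists k.
  apply: (@le_trans _ _ (L k + e / 3)%:E).
    by rewrite lee_fin mulrDl mul1r lerD2l ler_piMr// ltW.
  by rewrite EFinD leeD2r//; apply: ereal_sup_ubound; exists k.
apply: (@le_trans _ _ ((L f + e / 3)%:E + (L g + e / 3)%:E)%E).
  apply: leeD; first by rewrite EFinD -leeBlDr// ltW.
  apply: (@le_trans _ _ (inner_mass W)); last by rewrite EFinD -leeBlDr// ltW.
  by rewrite -riesz_outer_open//; exact: le_riesz_outer.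
have -> : ((L f + e / 3)%:E + (L g + e / 3)%:E =
    (L f + L g)%:E + (e / 3 + e / 3)%:E)%E.
  by rewrite -!EFinD; congr EFin; ring.
have -> : (e%:E = (e / 3)%:E + (e / 3 + e / 3)%:E)%E.
  by rewrite -EFinD; congr EFin; field.
by rewrite addeA leeD2r.
Qed.

End riesz_outer_measure.

(** * The Borel probability measure of a state, and integrals as states *)

Section riesz_measure.
Context {R : realType} {X : pmetricType R}.
Implicit Types f g : X -> R.

(** The Caratheodory-measurable sets form a sigma-algebra containing the open sets, so
    [riesz_outer L] restricts to a Borel measure, of total mass 1 since [L 1 = 1]. *)
Lemma riesz_probability (L : (X -> R) -> R) : compact [set: X] -> state L ->
  exists mu : borel_probability X, forall U g, open U -> below_indic U g ->
    ((L g)%:E <= mu U)%E.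
Proof.
move=> cX sL.
pose mu0 := riesz_outer L : set X -> \bar R.
have mu00 : mu0 set0 = 0%E.
  by rewrite /mu0 riesz_outer_open ?inner_mass0//; exact: open0.
pose outer := isOuterMeasure.Build R X mu0 mu00 (riesz_outer_ge0 sL)
  (@le_riesz_outer _ _ L) (riesz_outer_sigma_subadditive cX sL).
pose mu : {outer_measure set X -> \bar R} := HB.pack mu0 outer.
have cara (A : set X) : (measurable : set (set (borelType X))) A ->
    mu.-caratheodory A.
  apply: smallest_sub.
    split.
    - exact: caratheodory_measurable_set0.
    - by move=> B mB; rewrite setTD; exact: caratheodory_measurable_setC.
    - by move=> F mF; exact: caratheodory_measurable_bigcup.
  move=> U oU; apply: le_caratheodory_measurable => B.
  exact: open_caratheodory.
have sadd : semi_sigma_additive (mu0 : set (borelType X) -> \bar R).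
  move=> F mF tF mU.
  apply: (@caratheodory_measure_sigma_additive _ _ mu) => //.
  - by move=> i; exact: cara.
  - exact: cara.
have mu0T : mu0 setT = 1%E.
  by rewrite /mu0 riesz_outer_open ?inner_massT//; exact: openT.
pose measure0 :=
  isMeasure.Build _ (borelType X) R mu0 mu00 (riesz_outer_ge0 sL) sadd.
pose mm : {measure set (borelType X) -> \bar R} := HB.pack mu0 measure0.
pose prob := Measure_isProbability.Build _ (borelType X) R mm mu0T.
pose P : borel_probability X := HB.pack mu0 measure0 prob.
exists P => U g oU gU; change (((L g)%:E <= riesz_outer L U)%E).
by rewrite riesz_outer_open//; apply: ereal_sup_ubound; exists g.
Qed.

Variable mu : borel_probability X.
Hypothesis cX : compact [set: X].

Lemma continuous_borel_measurable f : continuous f ->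
  measurable_fun [set: borelType X] f.
Proof.
move=> /continuousP cf; apply: (measurability _ (RGenOpens.measurableE R)).
move=> _ [_ [a [b ->]] <-]; rewrite setTI.
by apply: sub_sigma_algebra; apply: cf; exact: interval_open.
Qed.

Lemma continuous_borel_integrable f : continuous f ->
  mu.-integrable setT (EFin \o f).
Proof.
move=> cf; apply: measurable_bounded_integrable => //.
- apply: (@le_lt_trans _ _ 1%E); last exact: ltry.
  by rewrite le_eqVlt; apply/orP; left; apply/eqP; exact: (probability_setT mu).
- exact: continuous_borel_measurable.
- have [M fM] := bounded_continuous cX cf.
  exists M; split; first exact: num_real.
  by move=> r Mr x _; exact: le_trans (fM x) (ltW Mr).
Qed.

(** Lets the algebra of states rewrite [L] and the integral alike. *)
Lemma integral_state : state (fun f => \int[mu]_x f x).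
Proof.
split=> [a f g cf cg|f _ f0|].
- rewrite RintegralD//; last exact: continuous_borel_integrable.
    by rewrite RintegralZl//; exact: continuous_borel_integrable.
  by apply: continuous_borel_integrable; exact: continuous_scale.
- by apply: Rintegral_ge0 => x _; exact: f0.
- rewrite Rintegral_cst// mul1r -[RHS]/(fine 1%E); congr fine.
  exact: (probability_setT mu).
Qed.

End riesz_measure.

(** * Comparison of a state with its measure by layer cake *)

Lemma sum_truncations (R : realDomainType) (y : R) n : 0 <= y -> y <= n%:R ->
  \sum_(k < n) Num.min 1 (Num.max 0 (y - k%:R)) = y.
Proof.
move=> y0 yn.
(* The summands cut [y] into slices of height 1, so the first [m] of them fill [y] up to height
   [m]. *)
suff H m : \sum_(k < m) Num.min 1 (Num.max 0 (y - k%:R)) = Num.min y m%:R.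
  by rewrite H; exact/min_idPl.
elim: m => [|m IH]; first by rewrite big_ord0; exact/esym/min_idPr.
rewrite big_ord_recr/= IH -natr1.
have [ym|my] := leP y m%:R.
  rewrite (max_idPl _) ?subr_le0// (min_idPr _) ?addr0 ?(min_idPl _)//.
  by rewrite (le_trans ym)// lerDl.
rewrite (max_idPr _) ?subr_ge0 ?ltW//.
have [ym|my'] := leP y (m%:R + 1).
  by rewrite (min_idPr _) ?subrKC// lerBlDl.
by rewrite (min_idPl _)// lerBrDl ltW.
Qed.

Lemma sum_indicators_le (R : realDomainType) (y : R) n : 0 <= y ->
  \sum_(k < n) (k%:R < y)%R%:R <= y + 1 :> R.
Proof.
move=> y0; elim: n => [|n IH]; first by rewrite big_ord0 addr_ge0.
rewrite big_ord_recr/=; have [ny|_] := ltP; last by rewrite addr0.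
(* Here the induction hypothesis is too weak; the first [n] terms are bounded by their number, which
   is below [y]. *)
rewrite lerD// (le_trans _ (ltW ny))//.
rewrite -[X in X%:R]card_ord -sumr_const; apply: ler_sum => i _.
by rewrite lern1 leq_b1.
Qed.

(** Cutting [N * f] at integer heights costs an additive error of at most 1, whatever [N] is;
    dividing by [N] makes it negligible. *)
Lemma le_state_integral (R : realType) (X : pmetricType R)
    (L : (X -> R) -> R) (mu : borel_probability X) (f : X -> R) :
  compact [set: X] -> state L ->
  (forall U g, open U -> below_indic U g -> ((L g)%:E <= mu U)%E) ->
  continuous f -> (forall x, 0 <= f x <= 1) -> L f <= \int[mu]_x f x.
Proof.
move=> cX sL Lmu cf f01; have sI := integral_state mu cX.
have bound n : n.+1%:R * L f <= n.+1%:R * \int[mu]_x f x + 1.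
  set N := n.+1%:R : R.
  have cNf : continuous (fun x => N * f x) by exact: continuous_scale.
  have Nf0 x : 0 <= N * f x by rewrite mulr_ge0//; case/andP: (f01 x).
  pose U k := [set x | k%:R < N * f x].
  pose h k x := Num.min 1 (Num.max 0 (N * f x - k%:R)).
  have ch k : continuous (h k).
    apply: continuous_minr; first exact: continuous_cst.
    apply: continuous_maxr; first exact: continuous_cst.
    by apply: continuous_sub => //; exact: continuous_cst.
  have oU k : open (U k).
    by move/continuousP : cNf => /(_ _ (@open_gt _ k%:R)).
  have hU k : below_indic (U k) (h k).
    split=> // x; first by rewrite le_min ler01 le_max lexx ge_min lexx.
    move=> /negP; rewrite -leNgt -subr_le0 => ?.
    by rewrite /h (max_idPl _)//; apply/min_idPr; exact: ler01.
  have mU k : measurable (U k : set (borelType X)) by exact: sub_sigma_algebra.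
  (* Layer cake: N f is the sum of the truncations h k, with h k <= 1_(U k),
     while the sum of the indicators of the U k is at most N f + 1. *)
  rewrite -state_scale//.
  have -> : (fun x => N * f x) = (fun x => \sum_(k < n.+1) h k x).
    apply/funext => x; rewrite sum_truncations// ler_piMr//.
    by case/andP: (f01 x).
  rewrite state_sum// -lee_fin -sumEFin.
  apply: (@le_trans _ _ (\sum_(k < n.+1) mu (U k))%E).
    by apply: lee_sum => k _; exact: Lmu.
  have -> : (\sum_(k < n.+1) mu (U k) =
      \int[mu]_x (\sum_(k < n.+1) (\1_(U k) x)%:E))%E.
    rewrite ge0_integral_sum//=.
    - by apply: eq_bigr => k _; rewrite integral_indic// setIT.
    - by move=> k; apply/measurable_EFinP; exact: measurable_indic.
  have cg : continuous (fun x => N * f x + 1).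
    by apply: continuous_add => //; exact: continuous_cst.
  have -> : N * (\int[mu]_x f x) + 1 = \int[mu]_x (N * f x + 1).
    by rewrite state_add ?state_scale ?state_cst//; exact: continuous_cst.
  rewrite /Rintegral fineK; last first.
    by apply: integrable_fin_num => //; exact: continuous_borel_integrable.
  apply: ge0_le_integral => //=.
  - by move=> x _; rewrite sume_ge0// => k _; rewrite lee_fin.
  - apply: emeasurable_sum => k; apply/measurable_EFinP.
    exact: measurable_indic.
  - by apply/measurable_EFinP; exact: continuous_borel_measurable.
  - move=> x _; rewrite sumEFin lee_fin.
    apply: le_trans (sum_indicators_le n.+1 (Nf0 x)).
    apply: ler_sum => k _; rewrite indicE.
    rewrite (_ : (x \in U k) = (k%:R < N * f x))//.
    by apply/idP/idP; rewrite inE.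
rewrite leNgt; apply/negP => If.
have d0 : 0 < L f - \int[mu]_x f x by rewrite subr_gt0.
pose n := Num.trunc (L f - \int[mu]_x f x)^-1.
have : (L f - \int[mu]_x f x)^-1 < n.+1%:R by exact: truncnS_gt.
rewrite -[X in X < _]mul1r ltr_pdivrMr// ltNge mulrBr lerBlDl.
by rewrite bound.
Qed.

(** The inequality on functions with values in [[0, 1]] extends to all continuous functions by an
    affine change, since [L] and the integral agree on constants. Applying it to [-f] gives the
    reverse inequality. *)
Lemma riesz_representation (R : realType) (X : pmetricType R)
    (L : (X -> R) -> R) : compact [set: X] -> state L ->
  exists mu : borel_probability X,
    forall f : X -> R, continuous f -> L f = \int[mu]_x f x.
Proof.
move=> cX sL; have [mu Lmu] := riesz_probability cX sL; exists mu.
have sI := integral_state mu cX.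
have le_LI (f : X -> R) : continuous f -> L f <= \int[mu]_x f x.
  move=> cf; have [M fM] := bounded_continuous cX cf.
  have M0 : 0 <= M by apply: le_trans (fM point).
  (* This scaling sends [f + (M + 1)] into [[0, 1]]; using [M + 1] keeps the denominator positive
     even if [M = 0]. *)
  pose c := (2 * (M + 1))^-1.
  have c0 : 0 < c by rewrite invr_gt0; lra.
  have cg : continuous (fun x => f x + (M + 1)).
    by apply: continuous_add => //; exact: continuous_cst.
  have := @le_state_integral _ _ _ mu (fun x => c * (f x + (M + 1))) cX sL Lmu.
  rewrite !state_scale// !state_add//; try exact: continuous_cst.
  rewrite !state_cst// ler_pM2l// lerD2r; apply; first exact: continuous_scale.
  move=> x; have := fM x; rewrite ler_norml => /andP[Mf fM'].
  have fM0 : 0 <= f x + (M + 1) by lra.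
  have fM1 : f x + (M + 1) <= 2 * (M + 1) by lra.
  by rewrite mulr_ge0 ?(ltW c0)//= mulrC ler_pdivrMr ?mul1r//; lra.
move=> f cf; apply/eqP; rewrite eq_le le_LI//=.
have cNf : continuous (fun x => -1 * f x) by exact: continuous_scale.
by have := le_LI _ cNf; rewrite !state_scale// !mulN1r lerN2.
Qed.

(** * Weak-star continuity and the variational principle *)

Lemma weakstar_integral_continuous (R : realType) (X : pmetricType R)
    (phi : continuousType X R) :
  continuous (fun nu : weakstar_probability X => \int[nu]_x phi x).
Proof.
move=> nu; apply: (@continuous_comp (weakstar_probability X)
  {ptws continuousType X R -> R} R (@weakstar_pairing R X) (fun I => I phi)).
  exact: (@initial_continuous _ _ (@weakstar_pairing R X)).
exact: (@proj_continuous _ _ phi).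
Qed.

Theorem theoremC (R : realType) (X : pmetricType R) (f : nat -> X -> X)
    (compactX : compact [set: X])
    (continuous_f : forall n, continuous (f n))
    (finite_entropy : (entropy_Mis R f < +oo)%E) :
  exists h : borel_probability X -> \bar R,
    [/\ forall mu, (h mu < +oo)%E,
        upper_semicontinuous (h : weakstar_probability X -> \bar R),
        forall phi : continuousType X R,
          is_maximum
            (range (fun mu => (h mu + (\int[mu]_x phi x)%:E)%E))
            (pressure_Mis f phi)
      & forall mu, h mu =
          ereal_inf (range (fun phi : continuousType X R =>
            (pressure_Mis f phi - (\int[mu]_x phi x)%:E)%E)) ].
Proof.
have Pfin (phi : X -> R) : continuous phi -> pressure_Mis f phi \is a fin_num.
  exact: (pressure_Mis_fin_num compactX finite_entropy point).
pose F (phi : continuousType X R) (mu : borel_probability X) :=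
  (pressure_Mis f phi - (\int[mu]_x phi x)%:E)%E.
pose h mu := ereal_inf (range (F ^~ mu)).
have hF mu phi : (h mu <= F phi mu)%E by apply: ereal_inf_lbound; exists phi.
exists h; split=> //.
- move=> mu; have c0 := @continuous_cst R X 0.
  apply: le_lt_trans (hF mu (mkcts c0)) _.
  by rewrite ltey_eq fin_numB Pfin.
(* An infimum of weak-star continuous functions is upper semicontinuous: one [phi] with
   [F phi mu < a] bounds [h] on a whole neighbourhood. *)
- move=> mu a /ereal_inf_lt[_ [phi _ <-]] Fa.
  have FE nu :
      (F phi nu < a%:E)%E = (fine (pressure_Mis f phi) - a < \int[nu]_x phi x).
    rewrite /F -[pressure_Mis f phi]fineK; last by apply: Pfin; exact: cts_fun.
    by rewrite -EFinB lte_fin ltrBlDr ltrBlDr addrC.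
  rewrite FE in Fa.
  exists [set nu : borel_probability X |
      fine (pressure_Mis f phi) - a < \int[nu]_x phi x].
    exact: (@weakstar_integral_continuous R X phi mu _ (lt_nbhsr Fa)).
  by move=> nu /=; rewrite -FE; exact: le_lt_trans.
- move=> phi; split.
    have cphi : continuous phi by exact: cts_fun.
    have [L sL hL] := pressure_Mis_subgradient compactX finite_entropy point cphi.
    have [mu Lmu] := riesz_representation compactX sL.
    exists mu => //; apply/eqP; rewrite eq_le; apply/andP; split.
      by rewrite -leeBrDr//; exact: hF.
    rewrite -leeBlDr//; apply: le_ereal_inf_tmp => _ [psi _ <-].
    have cpsi : continuous psi by exact: cts_fun.
    (* The subgradient inequality in the direction [psi - phi] says that [F phi mu <= F psi mu], so
       [phi] attains the infimum defining [h mu]. *)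
    have := hL _ (continuous_sub cpsi cphi).
    have -> : (fun x => phi x + (psi x - phi x)) = psi :> (X -> R).
      by apply/funext => x; rewrite addrC subrK.
    rewrite state_sub// !Lmu// EFinB => LP.
    rewrite /F leeBrDr// addeAC; apply: le_trans LP.
    by rewrite addeA.
  move=> _ [mu _ <-]; rewrite -leeBrDr//; exact: hF.
Qed.
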